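(* Let $a\in\mathbb{C}$ with $a\notin\{1,2\}$, and let $x,y\in\mathbb{C}$ satisfy $|x|+|y|<1$, $x\neq 0$ and $y\neq 0$. Then $$F_2\!\left(\left.{a;\,1,1\atop 2,2}\right|x,y\right)=\frac{1-(1-x)^{2-a}-(1-y)^{2-a}+(1-x-y)^{2-a}}{(1-a)(2-a)\,x\,y}.$$
   Context: Appell's bivariate hypergeometric function $F_2$ is defined by the double power series $$F_2\!\left(\left.{a;\,b_1,b_2\atop c_1,c_2}\right|x,y\right)=\sum_{i=0}^{\infty}\sum_{j=0}^{\infty}\frac{(a)_{i+j}\,(b_1)_i\,(b_2)_j}{(c_1)_i\,(c_2)_j\;i!\,j!}\,x^i\,y^j,$$ which converges absolutely for $|x|+|y|<1$ (with $c_1,c_2$ not zero or negative integers). Here $(a)_n=a(a+1)\cdots(a+n-1)$, $(a)_0=1$, is the Pochhammer symbol. In the claim $b_1=b_2=1$ and $c_1=c_2=2$. The complex powers $(1-x)^{2-a}$, $(1-y)^{2-a}$, $(1-x-y)^{2-a}$ are principal values (the bases have positive real part when $|x|+|y|<1$). *)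

(* Defs.v *)
From Stdlib Require Import Reals Lra Factorial.
From Coquelicot Require Import Coquelicot.
Open Scope C_scope.

(** ** Principal powers of complex numbers *)

Definition Cexp (z : C) : C :=
  (exp (Re z) * cos (Im z), exp (Re z) * sin (Im z))%R.

(* Principal argument, with values in (-PI, PI] (see [Carg_bound]).  The sign
   convention at [Im z = 0] gives argument PI to the negative reals.  The value
   at 0 is irrelevant. *)
Definition Carg (z : C) : R :=
  if Rle_dec 0 (Im z) then acos (Re z / Cmod z) else (- acos (Re z / Cmod z))%R.

Definition Clog (z : C) : C := (ln (Cmod z), Carg z).

(* Principal value of [z ^ w]; meaningful only for [z <> 0]. *)
Definition Cpower (z w : C) : C := Cexp (w * Clog z).

Lemma Re_div_Cmod_bound (z : C) : z <> 0 -> (-1 <= Re z / Cmod z <= 1)%R.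
Proof.
intros Hz.
assert (Hm : (0 < Cmod z)%R) by (now apply Cmod_gt_0).
assert (H := re_le_Cmod z). apply Rabs_le_between in H.
split; apply Rmult_le_reg_r with (Cmod z); trivial;
  unfold Rdiv; rewrite ?Rmult_assoc, Rinv_l; lra.
Qed.

Lemma Carg_bound (z : C) : z <> 0 -> (- PI < Carg z <= PI)%R.
Proof.
intros Hz. unfold Carg.
assert (Hb := Re_div_Cmod_bound z Hz).
assert (Ha := acos_bound (Re z / Cmod z)).
assert (HPI := PI_RGT_0).
destruct (Rle_dec 0 (Im z)) as [Hi|Hi]; [lra|].
split; [|lra].
destruct (Req_dec (acos (Re z / Cmod z)) PI) as [E|E]; [exfalso|lra].
assert (Hc := cos_acos _ Hb). rewrite E, cos_PI in Hc.
assert (Hm : (0 < Cmod z)%R) by (now apply Cmod_gt_0).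
assert (Hre : Re z = (- Cmod z)%R).
{ apply Rmult_eq_reg_r with (/ Cmod z)%R.
  - unfold Rdiv in Hc. rewrite <- Hc. field. lra.
  - apply Rinv_neq_0_compat. lra. }
assert (H2 := Cmod2_alt z).
nra.
Qed.

Lemma Cexp_Clog (z : C) : z <> 0 -> Cexp (Clog z) = z.
Proof.
intros Hz.
assert (Hb := Re_div_Cmod_bound z Hz).
assert (Hm : (0 < Cmod z)%R) by (now apply Cmod_gt_0).
assert (H2 := Cmod2_alt z).
assert (Hs : (Cmod z * sin (acos (Re z / Cmod z)) = Rabs (Im z))%R).
{ rewrite sin_acos by exact Hb.
  rewrite <- (sqrt_Rsqr (Cmod z)) at 1 by lra.
  rewrite <- sqrt_mult_alt by apply Rle_0_sqr.
  rewrite <- sqrt_Rsqr_abs. f_equal.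
  unfold Rsqr.
  transitivity (Cmod z ^ 2 - Re z ^ 2)%R; [field; lra | rewrite H2; ring]. }
unfold Cexp, Clog, Carg; simpl.
rewrite exp_ln by exact Hm.
destruct z as [u v]; simpl in *.
destruct (Rle_dec 0 v) as [Hi|Hi]; rewrite ?cos_neg, ?sin_neg.
- rewrite cos_acos, Hs, Rabs_pos_eq by assumption. f_equal. field. lra.
- rewrite cos_acos, <- Ropp_mult_distr_r, Hs, Rabs_left by (assumption || lra).
  f_equal; field. lra.
Qed.

(** ** Complex series *)

Definition CSeries (u : nat -> C) : C :=
  iota (T := C_CompleteNormedModule) (is_series (V := C_NormedModule) u).

Lemma CSeries_unique (u : nat -> C) (l : C) :
  is_series (V := C_NormedModule) u l -> CSeries u = l.
Proof.
exact (iota_filterlim_locally (V := C_CompleteNormedModule) (sum_n u) l).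
Qed.

Definition double_abs_convergent (t : nat -> nat -> C) : Prop :=
  (forall i, ex_series (fun j => Cmod (t i j))) /\
  ex_series (fun i => Series (fun j => Cmod (t i j))).

(** ** Appell's function F2 *)

Fixpoint Cpoch (a : C) (n : nat) : C :=
  match n with
  | O => 1
  | S m => Cpoch a m * (a + INR m)
  end.

Definition F2_term (a b1 b2 c1 c2 x y : C) (i j : nat) : C :=
  (Cpoch a (i + j) * Cpoch b1 i * Cpoch b2 j)
  / (Cpoch c1 i * Cpoch c2 j * INR (fact i) * INR (fact j))
  * x ^ i * y ^ j.

(* The iterated sum is the sum of the double series wherever the latter
   converges absolutely, i.e. under [double_abs_convergent (F2_term ...)]. *)
Definition F2 (a b1 b2 c1 c2 x y : C) : C :=
  CSeries (fun i => CSeries (fun j => F2_term a b1 b2 c1 c2 x y i j)).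

(* Main.v *)
Require Import Defs.
From Stdlib Require Import Reals Lra Lia Factorial.
From Coquelicot Require Import Coquelicot.
Open Scope C_scope.

(** With [b = a - 2], the coefficient [(a)_{i+j} / ((i+1)! (j+1)!)] of the series
    is [(b)_{m+n} / (m! n!)] divided by [b (b + 1)], where [m = i + 1] and
    [n = j + 1].  Summed over all [m, n >= 0], the terms
    [(b)_{m+n} x^m y^n / (m! n!)] give [(1 - x - y)^{-b}]: by the binomial series
    the sum over [n] is [(b)_m (1 - y)^{-b-m}], and the sum over [m] is then a
    binomial series in [x / (1 - y)].  The terms with [m = 0] or [n = 0] are
    removed by inclusion-exclusion.  The real binomial series with parameter
    [|a| + 1] is a majorant. *)

(** * Complex exponential and logarithm *)

Lemma Cexp_plus (u v : C) : Cexp (u + v) = Cexp u * Cexp v.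
Proof.
destruct u as [a b], v as [c d]. unfold Cexp, Cmult, Cplus; simpl.
rewrite exp_plus, cos_plus, sin_plus. f_equal; ring.
Qed.

Lemma Cexp_0 : Cexp 0 = 1.
Proof.
unfold Cexp; simpl. rewrite exp_0, cos_0, sin_0.
unfold RtoC. f_equal; ring.
Qed.

Lemma Cexp_opp (u : C) : Cexp (- u) * Cexp u = 1.
Proof. rewrite <- Cexp_plus, <- Cexp_0. f_equal. ring. Qed.

Lemma Cexp_INR_mult (n : nat) (u : C) : Cexp (INR n * u) = Cexp u ^ n.
Proof.
induction n as [|n IH].
- simpl. rewrite <- Cexp_0. f_equal. ring.
- rewrite S_INR, RtoC_plus, Cpow_S, <- IH, <- Cexp_plus. f_equal. ring.
Qed.

(** An integer multiple of the logarithm exponentiates to an honest power. This isolates the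
    dependence of [(1 - y)^(-b-m)] on [m] as a geometric factor, which is what lets the sum over [m]
    become a binomial series in [x / (1 - y)]. *)
Lemma Cpower_opp_plus_INR (w b : C) (m : nat) :
  w <> 0 -> Cpower w (- (b + INR m)) = Cpower w (- b) * (/ w) ^ m.
Proof.
intros Hw. unfold Cpower.
replace (- (b + INR m) * Clog w) with (- b * Clog w + INR m * (- Clog w)) by ring.
rewrite Cexp_plus, Cexp_INR_mult. do 2 f_equal.
rewrite <- (Cexp_Clog w Hw) at 2.
assert (H := Cexp_opp (Clog w)).
assert (H0 : Cexp (Clog w) <> 0) by (now rewrite Cexp_Clog).
rewrite <- (Cmult_1_l (/ _)), <- H. field. exact H0.
Qed.

Lemma neq_0_of_Re_gt_0 (w : C) : (0 < Re w)%R -> w <> 0.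
Proof. intros H E. rewrite E in H. simpl in H. lra. Qed.

Lemma Cmod_mult_cos_Carg (w : C) : w <> 0 -> (Cmod w * cos (Carg w) = Re w)%R.
Proof.
intros Hw. assert (H := Cexp_Clog w Hw).
assert (Hm : (0 < Cmod w)%R) by (now apply Cmod_gt_0).
apply (f_equal Re) in H. unfold Cexp, Clog in H; simpl in H.
now rewrite exp_ln in H.
Qed.

Lemma Cmod_mult_sin_Carg (w : C) : w <> 0 -> (Cmod w * sin (Carg w) = Im w)%R.
Proof.
intros Hw. assert (H := Cexp_Clog w Hw).
assert (Hm : (0 < Cmod w)%R) by (now apply Cmod_gt_0).
apply (f_equal Im) in H. unfold Cexp, Clog in H; simpl in H.
now rewrite exp_ln in H.
Qed.

(** [cos (Carg w)] has the sign of [Re w], whereas the cosine is nonpositive on [[PI/2, PI]]. *)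
Lemma Carg_bound_Re_gt_0 (w : C) :
  (0 < Re w)%R -> (- (PI / 2) < Carg w < PI / 2)%R.
Proof.
intros Hw. assert (H0 := neq_0_of_Re_gt_0 w Hw).
assert (Hm : (0 < Cmod w)%R) by (now apply Cmod_gt_0).
assert (Hc := Cmod_mult_cos_Carg w H0).
assert (Hb := Carg_bound w H0).
assert (HPI := PI_RGT_0).
assert (Hp : (0 < cos (Carg w))%R) by nra.
split; apply Rnot_le_lt; intros Hle.
- rewrite <- cos_neg in Hp.
  assert (cos (- Carg w) <= 0)%R by (apply cos_le_0; lra). lra.
- assert (cos (Carg w) <= 0)%R by (apply cos_le_0; lra). lra.
Qed.

(** The definition of [Carg] by cases on [acos] is awkward to differentiate at the positive real
    axis, where [acos] is evaluated at 1. The [atan] form is smooth on the whole right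
    half-plane. *)
Lemma Carg_atan (w : C) : (0 < Re w)%R -> Carg w = atan (Im w / Re w).
Proof.
intros Hw. assert (H0 := neq_0_of_Re_gt_0 w Hw).
assert (Hm : (0 < Cmod w)%R) by (now apply Cmod_gt_0).
assert (Hc := Cmod_mult_cos_Carg w H0).
rewrite <- (atan_tan (Carg w)) by (now apply Carg_bound_Re_gt_0).
f_equal. rewrite <- Hc, <- (Cmod_mult_sin_Carg w H0). unfold tan.
field. split; [nra|lra].
Qed.

(** By [cos d = 1 - 2 sin^2 (d/2)], the sine of [d/2] vanishes, and [d/2] lies in [(-PI, PI)]. *)
Lemma cos_1_eq_0 (d : R) : (- (2 * PI) < d < 2 * PI)%R -> cos d = 1%R -> d = 0%R.
Proof.
intros Hd Hc.
replace d with (2 * (d / 2))%R in Hc by field.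
rewrite cos_2a_sin in Hc.
destruct (Rtotal_order d 0) as [H|[H|H]]; trivial; exfalso.
- assert (0 < sin (- (d / 2)))%R by (apply sin_gt_0; lra).
  rewrite sin_neg in *. nra.
- assert (0 < sin (d / 2))%R by (apply sin_gt_0; lra). nra.
Qed.

(* The arguments of [u], [v] and [u * v] lie in (-PI/2, PI/2), so there is no
   room for a multiple of 2 PI. *)
Lemma Clog_mult (u v : C) :
  (0 < Re u)%R -> (0 < Re v)%R -> (0 < Re (u * v))%R ->
  Clog (u * v) = Clog u + Clog v.
Proof.
intros Hu Hv Huv.
assert (Hu0 := neq_0_of_Re_gt_0 u Hu).
assert (Hv0 := neq_0_of_Re_gt_0 v Hv).
assert (Huv0 := neq_0_of_Re_gt_0 _ Huv).
assert (Mu : (0 < Cmod u)%R) by (now apply Cmod_gt_0).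
assert (Mv : (0 < Cmod v)%R) by (now apply Cmod_gt_0).
unfold Clog, Cplus; simpl. f_equal.
- rewrite Cmod_mult. now apply ln_mult.
- assert (Bu := Carg_bound_Re_gt_0 u Hu).
  assert (Bv := Carg_bound_Re_gt_0 v Hv).
  assert (Buv := Carg_bound_Re_gt_0 _ Huv).
  enough (Carg (u * v) - (Carg u + Carg v) = 0)%R by lra.
  apply cos_1_eq_0; [lra|].
  assert (C1 := Cmod_mult_cos_Carg u Hu0).
  assert (S1 := Cmod_mult_sin_Carg u Hu0).
  assert (C2 := Cmod_mult_cos_Carg v Hv0).
  assert (S2 := Cmod_mult_sin_Carg v Hv0).
  assert (C3 := Cmod_mult_cos_Carg _ Huv0).
  assert (S3 := Cmod_mult_sin_Carg _ Huv0).
  rewrite Cmod_mult in C3, S3.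
  rewrite cos_minus, cos_plus, sin_plus.
  assert (Ec : cos (Carg (u * v)) =
    (cos (Carg u) * cos (Carg v) - sin (Carg u) * sin (Carg v))%R).
  { apply Rmult_eq_reg_l with (Cmod u * Cmod v)%R; [|nra].
    rewrite C3. change (Re (u * v)) with (Re u * Re v - Im u * Im v)%R.
    rewrite <- C1, <- C2, <- S1, <- S2. ring. }
  assert (Es : sin (Carg (u * v)) =
    (sin (Carg u) * cos (Carg v) + cos (Carg u) * sin (Carg v))%R).
  { apply Rmult_eq_reg_l with (Cmod u * Cmod v)%R; [|nra].
    rewrite S3. change (Im (u * v)) with (Re u * Im v + Im u * Re v)%R.
    rewrite <- C1, <- C2, <- S1, <- S2. ring. }
  rewrite <- Ec, <- Es. assert (H := sin2_cos2 (Carg (u * v))).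
  unfold Rsqr in H. lra.
Qed.

Lemma Re_1_minus_gt_0 (z : C) : (Cmod z < 1)%R -> (0 < Re (1 - z))%R.
Proof.
intros Hz. assert (H := re_le_Cmod z). apply Rabs_le_between in H.
destruct z as [p q]; simpl in *. lra.
Qed.

(** * Series of complex numbers *)

(** Neighbourhoods in [C] are those of the product [R * R], so convergence may be checked on each
    component. Real power series are carried over to [C] this way. *)
Lemma is_series_pair (u : nat -> C) (l : C) :
  is_series (fun n => Re (u n)) (Re l) -> is_series (fun n => Im (u n)) (Im l) ->
  is_series (V := C_NormedModule) u l.
Proof.
intros Hr Hi.
assert (E : forall n, sum_n u n =
  (sum_n (fun k => Re (u k)) n, sum_n (fun k => Im (u k)) n)).
{ induction n as [|n IH].
  - rewrite !sum_O. now destruct (u 0%nat).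
  - rewrite !sum_Sn, IH. reflexivity. }
unfold is_series.
apply filterlim_ext with
  (fun n => (sum_n (fun k => Re (u k)) n, sum_n (fun k => Im (u k)) n)).
{ intros n. symmetry. apply E. }
intros P [eps HP].
assert (H1 := Hr (ball (Re l) eps) (locally_ball _ eps)).
assert (H2 := Hi (ball (Im l) eps) (locally_ball _ eps)).
unfold filtermap in *.
generalize (filter_and _ _ H1 H2). apply filter_imp.
intros n [A B]. apply HP. split; assumption.
Qed.

Lemma is_Cseries_unique (u : nat -> C) (l1 l2 : C) :
  is_series (V := C_NormedModule) u l1 -> is_series (V := C_NormedModule) u l2 ->
  l1 = l2.
Proof.
intros H1 H2. now rewrite <- (CSeries_unique u l1 H1), <- (CSeries_unique u l2 H2).
Qed.

(** From here to [is_Cseries_incr_1], general facts on series are restated with the concrete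
    operations of [C] in place of the abstract module operations, so that [ring] and rewriting apply
    to the terms and the sums. *)
Lemma is_Cseries_ext (u v : nat -> C) (l : C) :
  (forall n, u n = v n) -> is_series (V := C_NormedModule) u l ->
  is_series (V := C_NormedModule) v l.
Proof. exact (is_series_ext (V := C_NormedModule) u v l). Qed.

Lemma is_Cseries_scal (c : C) (u : nat -> C) (l : C) :
  is_series (V := C_NormedModule) u l ->
  is_series (V := C_NormedModule) (fun n => c * u n) (c * l).
Proof. exact (is_series_scal (V := C_NormedModule) c u l). Qed.

Lemma is_Cseries_plus (u v : nat -> C) (l k : C) :
  is_series (V := C_NormedModule) u l -> is_series (V := C_NormedModule) v k ->
  is_series (V := C_NormedModule) (fun n => u n + v n) (l + k).
Proof. exact (is_series_plus (V := C_NormedModule) u v l k). Qed.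

Lemma is_Cseries_decr_1 (u : nat -> C) (l : C) :
  is_series (V := C_NormedModule) (fun n => u (S n)) (l - u 0%nat) ->
  is_series (V := C_NormedModule) u l.
Proof. exact (is_series_decr_1 (V := C_NormedModule) u l). Qed.

Lemma is_Cseries_incr_1 (u : nat -> C) (l : C) :
  is_series (V := C_NormedModule) u l ->
  is_series (V := C_NormedModule) (fun n => u (S n)) (l - u 0%nat).
Proof.
intros H. apply (is_series_incr_1 (V := C_NormedModule) u).
evar_last; [exact H|].
change (l = l - u 0%nat + u 0%nat). ring.
Qed.

Lemma im_le_Cmod (z : C) : (Rabs (Im z) <= Cmod z)%R.
Proof.
eapply Rle_trans; [|apply Rmax_Cmod]. apply Rmax_r.
Qed.

(** * Pochhammer symbols and a majorant *)

Fixpoint Rpoch (A : R) (n : nat) : R :=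
  match n with
  | O => 1
  | S m => Rpoch A m * (A + INR m)
  end.

Lemma RtoC_Rpoch (A : R) (n : nat) : RtoC (Rpoch A n) = Cpoch A n.
Proof.
induction n as [|n IH]; [reflexivity|].
cbn [Rpoch Cpoch]. now rewrite RtoC_mult, RtoC_plus, IH.
Qed.

Lemma Rpoch_gt_0 (A : R) (n : nat) : (0 < A)%R -> (0 < Rpoch A n)%R.
Proof.
intros HA. induction n as [|n IH]; simpl; [lra|].
assert (H := pos_INR n). apply Rmult_lt_0_compat; lra.
Qed.

Lemma Cmod_INR (n : nat) : Cmod (INR n) = INR n.
Proof. rewrite Cmod_R. apply Rabs_pos_eq, pos_INR. Qed.

(** The triangle inequality applied to each factor [b + k]. *)
Lemma Cmod_Cpoch_le (b : C) (A : R) (n : nat) :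
  (Cmod b <= A)%R -> (Cmod (Cpoch b n) <= Rpoch A n)%R.
Proof.
intros HA. induction n as [|n IH]; cbn [Rpoch Cpoch].
- rewrite Cmod_1. lra.
- rewrite Cmod_mult. apply Rmult_le_compat; try apply Cmod_ge_0; trivial.
  eapply Rle_trans; [apply Cmod_triangle|]. rewrite Cmod_INR. lra.
Qed.

Lemma INR_fact_gt_0 (n : nat) : (0 < INR (fact n))%R.
Proof. apply lt_0_INR, lt_O_fact. Qed.

Lemma RtoC_neq_0 (r : R) : (0 < r)%R -> RtoC r <> 0.
Proof. intros H E. apply RtoC_inj in E. lra. Qed.

Lemma C_fact_neq_0 (n : nat) : RtoC (INR (fact n)) <> 0.
Proof. apply RtoC_neq_0, INR_fact_gt_0. Qed.

Lemma C_INR_S_neq_0 (n : nat) : RtoC (INR (S n)) <> 0.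
Proof. apply RtoC_neq_0, lt_0_INR. lia. Qed.

Lemma C_fact_S (n : nat) : RtoC (INR (fact (S n))) = INR (S n) * INR (fact n).
Proof. rewrite fact_simpl, mult_INR. apply RtoC_mult. Qed.

(** Ratio test; positivity of [A] and [X] keeps every term nonzero. *)
Lemma ex_series_binomial (A X : R) :
  (0 < A)%R -> (0 < X < 1)%R ->
  ex_series (fun n => Rpoch A n / INR (fact n) * X ^ n)%R.
Proof.
intros HA HX.
set (u := fun n => (Rpoch A n / INR (fact n) * X ^ n)%R).
assert (Hu : forall n, (0 < u n)%R).
{ intros n. unfold u, Rdiv. repeat apply Rmult_lt_0_compat.
  - now apply Rpoch_gt_0.
  - apply Rinv_0_lt_compat, INR_fact_gt_0.
  - apply pow_lt; lra. }
apply ex_series_ext with (fun n => Rabs (u n)).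
{ intros n. apply Rabs_pos_eq, Rlt_le, Hu. }
apply ex_series_DAlembert with X; [lra| |].
{ intros n. apply Rgt_not_eq, Hu. }
(* The ratio of consecutive terms is [(A + n) X / (n + 1)], rewritten so that its limit [X] is
   visible. *)
apply is_lim_seq_ext with (fun n => X + (A - 1) * X * / INR (S n))%R.
{ intros n. rewrite Rabs_pos_eq.
  2:{ apply Rlt_le, Rdiv_lt_0_compat; apply Hu. }
  unfold u. rewrite fact_simpl, mult_INR. cbn [Rpoch pow].
  assert (H1 := Rpoch_gt_0 A n HA). assert (H2 := INR_fact_gt_0 n).
  assert (H3 : (0 < X ^ n)%R) by (apply pow_lt; lra).
  rewrite S_INR. assert (H4 := pos_INR n). field. repeat split; lra. }
assert (Hinv : is_lim_seq (fun n => / INR (S n))%R 0%R).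
{ apply (is_lim_seq_incr_1 (fun n => / INR n)%R).
  exact (is_lim_seq_inv _ p_infty is_lim_seq_INR ltac:(discriminate)). }
evar_last.
{ apply is_lim_seq_plus'; [apply is_lim_seq_const|].
  apply is_lim_seq_mult'; [apply is_lim_seq_const|exact Hinv]. }
simpl. f_equal. ring.
Qed.

Lemma Cpoch_plus (b : C) (m n : nat) :
  Cpoch b (m + n) = Cpoch b m * Cpoch (b + INR m) n.
Proof.
induction n as [|n IH].
- rewrite Nat.add_0_r. simpl. ring.
- rewrite Nat.add_succ_r. cbn [Cpoch]. rewrite IH, plus_INR, RtoC_plus. ring.
Qed.

Lemma Cpoch_1 (n : nat) : Cpoch 1 n = INR (fact n).
Proof.
induction n as [|n IH]; [reflexivity|].
rewrite C_fact_S. cbn [Cpoch]. rewrite IH, S_INR, RtoC_plus. ring.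
Qed.

Lemma Cpoch_2 (n : nat) : Cpoch 2 n = INR (fact (S n)).
Proof.
rewrite <- Cpoch_1. change (S n) with (1 + n)%nat.
rewrite Cpoch_plus. simpl Cpoch at 2. simpl INR.
replace (1 + 1) with (RtoC 2) by (rewrite <- RtoC_plus; f_equal; ring). ring.
Qed.

(** * The binomial series *)

(** Differentiation is needed only along a real segment; the componentwise form reduces it to real
    calculus, including [auto_derive] and the constancy of a function with zero derivative. *)
Definition is_derive_RC (f : R -> C) (t : R) (l : C) : Prop :=
  is_derive (fun s => Re (f s)) t (Re l) /\ is_derive (fun s => Im (f s)) t (Im l).

Lemma is_derive_RC_scal (c : C) (f : R -> C) (t : R) (l : C) :
  is_derive_RC f t l -> is_derive_RC (fun s => c * f s) t (c * l).
Proof.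
intros [H1 H2]. destruct c as [c1 c2]. split; simpl.
- apply (is_derive_minus (fun s => c1 * Re (f s))%R (fun s => c2 * Im (f s))%R);
    now apply is_derive_scal.
- apply (is_derive_plus (fun s => c1 * Im (f s))%R (fun s => c2 * Re (f s))%R);
    now apply is_derive_scal.
Qed.

Lemma is_derive_RC_mult (f g : R -> C) (t : R) (l k : C) :
  is_derive_RC f t l -> is_derive_RC g t k ->
  is_derive_RC (fun s => f s * g s) t (l * g t + f t * k).
Proof.
intros [F1 F2] [G1 G2].
assert (M : forall u v : R -> R, forall du dv, is_derive u t du -> is_derive v t dv ->
  is_derive (fun s => u s * v s)%R t (du * v t + u t * dv)%R).
{ intros u v du dv Hu Hv.
  exact (is_derive_mult u v t du dv Hu Hv Rmult_comm). }
split.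
- apply (is_derive_ext (fun s => Re (f s) * Re (g s) - Im (f s) * Im (g s))%R).
  { reflexivity. }
  evar_last.
  { apply (is_derive_minus (fun s => Re (f s) * Re (g s))%R
      (fun s => Im (f s) * Im (g s))%R); apply M; eassumption. }
  unfold minus, plus, opp, Re, Im; simpl. ring.
- apply (is_derive_ext (fun s => Re (f s) * Im (g s) + Im (f s) * Re (g s))%R).
  { reflexivity. }
  evar_last.
  { apply (is_derive_plus (fun s => Re (f s) * Im (g s))%R
      (fun s => Im (f s) * Re (g s))%R); apply M; eassumption. }
  unfold plus, Re, Im; simpl. ring.
Qed.

Lemma is_derive_RC_Cexp (f : R -> C) (t : R) (l : C) :
  is_derive_RC f t l -> is_derive_RC (fun s => Cexp (f s)) t (l * Cexp (f t)).
Proof.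
intros [H1 H2]. unfold is_derive_RC, Cexp; simpl.
set (A := fun s => Re (f s)) in *. set (B := fun s => Im (f s)) in *.
change (Re (f t)) with (A t). change (Im (f t)) with (B t).
assert (DA : ex_derive A t) by (now exists (Re l)).
assert (DB : ex_derive B t) by (now exists (Im l)).
assert (E1 : Derive A t = fst l) by (apply is_derive_unique, H1).
assert (E2 : Derive B t = snd l) by (apply is_derive_unique, H2).
split.
- change (is_derive (fun s => exp (A s) * cos (B s))%R t
    (fst l * (exp (A t) * cos (B t)) - snd l * (exp (A t) * sin (B t)))%R).
  auto_derive; [tauto|].
  change (Derive (fun x => A x) t) with (Derive A t).
  change (Derive (fun x => B x) t) with (Derive B t).
  rewrite E1, E2. ring.
- change (is_derive (fun s => exp (A s) * sin (B s))%R t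
    (fst l * (exp (A t) * sin (B t)) + snd l * (exp (A t) * cos (B t)))%R).
  auto_derive; [tauto|].
  change (Derive (fun x => A x) t) with (Derive A t).
  change (Derive (fun x => B x) t) with (Derive B t).
  rewrite E1, E2. ring.
Qed.

Lemma eq_of_is_derive_RC_0 (f : R -> C) :
  (forall t, (0 <= t <= 1)%R -> is_derive_RC f t 0) -> f 0%R = f 1%R.
Proof.
intros H. apply injective_projections.
- apply (eq_is_derive (fun s => Re (f s)) 0 1); [|lra].
  intros t Ht. apply H, Ht.
- apply (eq_is_derive (fun s => Im (f s)) 0 1); [|lra].
  intros t Ht. apply H, Ht.
Qed.

Lemma Clog_Re_gt_0 (w : C) : (0 < Re w)%R ->
  Clog w = (ln (Re w ^ 2 + Im w ^ 2) / 2, atan (Im w / Re w))%R.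
Proof.
intros Hw. unfold Clog. f_equal; [|now apply Carg_atan].
assert (Hm : (0 < Cmod w)%R) by (now apply Cmod_gt_0, neq_0_of_Re_gt_0).
rewrite <- Cmod2_alt. simpl. rewrite Rmult_1_r, ln_mult by trivial. field.
Qed.

Lemma is_derive_RC_Clog_segment (z : C) (t : R) :
  (Cmod z < 1)%R -> (0 <= t <= 1)%R ->
  is_derive_RC (fun s => Clog (1 - s * z)) t (- z / (1 - t * z)).
Proof.
intros Hz Ht.
assert (Hp : forall s : R, Re (1 - s * z) = (1 - s * Re z)%R)
  by (intros s; destruct z; simpl; ring).
assert (Hq : forall s : R, Im (1 - s * z) = (- (s * Im z))%R)
  by (intros s; destruct z; simpl; ring).
assert (H1 := re_le_Cmod z). apply Rabs_le_between in H1.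
assert (Hpos : (0 < 1 - t * Re z)%R) by nra.
(* The closed form of [Clog] is valid only in the right half-plane. This is an open condition on
   [s], so it holds on both sides of [t], also at the endpoints 0 and 1. *)
assert (Hloc : locally t (fun s => (0 < 1 - s * Re z)%R)).
{ apply (continuous_comp (fun s => 1 - s * Re z)%R (fun y => y));
  [| apply continuous_id | now apply (open_gt 0%R) ].
  apply (ex_derive_continuous (fun s => 1 - s * Re z)%R). auto_derive. trivial. }
assert (Hw : (0 < (1 - t * Re z) ^ 2 + (t * Im z) ^ 2)%R) by nra.
split.
- apply is_derive_ext_loc with
    (fun s => ln ((1 - s * Re z) ^ 2 + (s * Im z) ^ 2) / 2)%R.
  { revert Hloc. apply filter_imp. intros s Hs.
    rewrite Clog_Re_gt_0 by (now rewrite Hp). rewrite Hp, Hq. simpl.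
    do 2 f_equal. ring. }
  auto_derive; [lra|].
  destruct z as [p q]; simpl in *. field. nra.
- apply is_derive_ext_loc with
    (fun s => atan (- (s * Im z) / (1 - s * Re z)))%R.
  { revert Hloc. apply filter_imp. intros s Hs.
    rewrite Clog_Re_gt_0 by (now rewrite Hp). now rewrite Hp, Hq. }
  auto_derive; [lra|].
  destruct z as [p q]; simpl in *. field. repeat split; nra.
Qed.

(** Beyond the radius of convergence the terms cannot tend to 0, but the terms of a convergent
    series do. *)
Lemma CV_radius_ge (u : nat -> R) (r : R) :
  (0 <= r)%R -> ex_series (fun n => Rabs (u n * r ^ n)) -> Rbar_le r (CV_radius u).
Proof.
intros Hr H. apply Rbar_not_lt_le. intros Hlt.
apply (CV_disk_outside u r).
- now rewrite (Rabs_pos_eq r Hr).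
- now apply ex_series_lim_0, ex_series_Rabs.
Qed.

Definition binomial_term (b z : C) (n : nat) : C := Cpoch b n / INR (fact n) * z ^ n.

Lemma binomial_term_S (b z : C) (n : nat) :
  INR (S n) * binomial_term b z (S n) = (b + INR n) * z * binomial_term b z n.
Proof.
unfold binomial_term. rewrite C_fact_S, Cpow_S. cbn [Cpoch]. field.
split; [apply C_fact_neq_0|apply C_INR_S_neq_0].
Qed.

Lemma Cmod_binomial_term_le (b z : C) (A X : R) (n : nat) :
  (Cmod b <= A)%R -> (Cmod z <= X)%R ->
  (Cmod (binomial_term b z n) <= Rpoch A n / INR (fact n) * X ^ n)%R.
Proof.
intros HA HX. unfold binomial_term.
rewrite Cmod_mult, Cmod_div, Cmod_pow, Cmod_INR by apply C_fact_neq_0.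
assert (H := INR_fact_gt_0 n).
apply Rmult_le_compat.
- apply Rdiv_le_0_compat; [apply Cmod_ge_0|exact H].
- apply pow_le, Cmod_ge_0.
- apply Rmult_le_compat_r; [now apply Rlt_le, Rinv_0_lt_compat|].
  now apply Cmod_Cpoch_le.
- apply pow_incr. split; [apply Cmod_ge_0|exact HX].
Qed.

(** Here [f] stands for [Re] or [Im]. The strict inequality allows termwise differentiation on all
    of [[0, 1]], including the endpoint 1 where the series is evaluated. *)
Lemma CV_radius_binomial_term (b z : C) (f : C -> R) :
  (forall w, Rabs (f w) <= Cmod w)%R -> (Cmod z < 1)%R ->
  Rbar_lt 1 (CV_radius (fun n => f (binomial_term b z n))).
Proof.
intros Hf Hz. assert (Hz0 := Cmod_ge_0 z).
(* The choice gives [Cmod z < p < q < 1], with [p > 0] even for [z = 0]. Terms bounded by powers of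
   [p] and evaluated at [q / p > 1] are majorised by powers of [q]. *)
set (p := ((1 + Cmod z) / 2)%R). set (q := ((1 + p) / 2)%R).
assert (Hp : (0 < p < 1)%R) by (unfold p; lra).
assert (Hq : (p < q < 1)%R) by (unfold q; lra).
assert (Hr : (1 < q / p)%R).
{ apply Rmult_lt_reg_r with p; [lra|]. unfold Rdiv.
  rewrite Rmult_assoc, Rinv_l; lra. }
apply Rbar_lt_le_trans with (q / p)%R; [exact Hr|].
apply CV_radius_ge; [lra|].
assert (Hb := Cmod_ge_0 b).
apply (ex_series_le (V := R_CompleteNormedModule)) with
  (fun n => Rpoch (Cmod b + 1) n / INR (fact n) * q ^ n)%R;
  [|apply ex_series_binomial; lra].
intros n. change (norm ?x) with (Rabs x). rewrite Rabs_Rabsolu, Rabs_mult.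
rewrite (Rabs_pos_eq ((q / p) ^ n)) by (apply pow_le; lra).
apply Rle_trans with
  (Rpoch (Cmod b + 1) n / INR (fact n) * p ^ n * (q / p) ^ n)%R.
- apply Rmult_le_compat_r; [apply pow_le; lra|].
  eapply Rle_trans; [apply Hf|].
  apply Cmod_binomial_term_le; unfold p; lra.
- rewrite Rmult_assoc, <- Rpow_mult_distr.
  replace (p * (q / p))%R with q by (field; lra). apply Rle_refl.
Qed.

(* [G t] is the sum of the binomial series at [t z].  The recurrence
   [binomial_term_S] is the differential equation [(1 - t z) G' = b z G], so
   [G t * (1 - t z) ^ b] is constant on [0, 1]. *)
Lemma is_series_binomial (b z : C) :
  (Cmod z < 1)%R ->
  is_series (V := C_NormedModule) (binomial_term b z) (Cpower (1 - z) (- b)).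
Proof.
intros Hz.
set (c := binomial_term b z).
set (cr := fun n => Re (c n)). set (ci := fun n => Im (c n)).
assert (Rr : Rbar_lt 1 (CV_radius cr))
  by exact (CV_radius_binomial_term b z Re re_le_Cmod Hz).
assert (Ri : Rbar_lt 1 (CV_radius ci))
  by exact (CV_radius_binomial_term b z Im im_le_Cmod Hz).
set (G := fun t => (PSeries cr t, PSeries ci t) : C).
set (G' := fun t => (PSeries (PS_derive cr) t, PSeries (PS_derive ci) t) : C).
assert (Hin : forall (u : nat -> R) t, Rbar_lt 1 (CV_radius u) -> (0 <= t <= 1)%R ->
  Rbar_lt (Rabs t) (CV_radius u)).
{ intros u t Hu Ht. apply Rbar_le_lt_trans with 1%R; [|exact Hu].
  simpl. rewrite Rabs_pos_eq; lra. }
assert (HG : forall t, (0 <= t <= 1)%R ->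
  is_series (V := C_NormedModule) (fun n => t ^ n * c n) (G t)).
{ intros t Ht. apply is_series_pair.
  - apply is_series_ext with (fun n => cr n * t ^ n)%R.
    { intros n. rewrite <- RtoC_pow, re_scal_l. apply Rmult_comm. }
    apply is_pseries_R, PSeries_correct, CV_radius_inside, Hin; assumption.
  - apply is_series_ext with (fun n => ci n * t ^ n)%R.
    { intros n. rewrite <- RtoC_pow, im_scal_l. apply Rmult_comm. }
    apply is_pseries_R, PSeries_correct, CV_radius_inside, Hin; assumption. }
assert (HG' : forall t, (0 <= t <= 1)%R ->
  is_series (V := C_NormedModule) (fun n => t ^ n * (INR (S n) * c (S n))) (G' t)).
{ intros t Ht. apply is_series_pair.
  - apply is_series_ext with (fun n => PS_derive cr n * t ^ n)%R.
    { intros n. rewrite <- RtoC_pow, !re_scal_l. apply Rmult_comm. }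
    apply is_pseries_R, PSeries_correct, CV_radius_inside.
    rewrite CV_radius_derive. now apply Hin.
  - apply is_series_ext with (fun n => PS_derive ci n * t ^ n)%R.
    { intros n. rewrite <- RtoC_pow, !im_scal_l. apply Rmult_comm. }
    apply is_pseries_R, PSeries_correct, CV_radius_inside.
    rewrite CV_radius_derive. now apply Hin. }
assert (HD : forall t, (0 <= t <= 1)%R -> is_derive_RC G t (G' t)).
{ intros t Ht. split; apply is_derive_PSeries; now apply Hin. }
assert (ODE : forall t, (0 <= t <= 1)%R -> (1 - t * z) * G' t = b * z * G t).
{ intros t Ht.
  (* Both sides are sums of the same series, by the recurrence for [(n + 1) c (n + 1)]. The series
     of [n c n t^n] sums to [t * G' t]: its term of index 0 vanishes, and the rest is a shift of the
     series of [G']. *)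
  enough (E : G' t = b * z * G t + z * (t * G' t))
    by (transitivity (G' t - z * (t * G' t)); [ring|rewrite E at 1; ring]).
  eapply is_Cseries_unique; [apply HG', Ht|].
  apply is_Cseries_ext with (fun n => b * z * (t ^ n * c n) + z * (t ^ n * (INR n * c n))).
  { intros n. unfold c. rewrite binomial_term_S.
    ring. }
  apply is_Cseries_plus; apply is_Cseries_scal; [apply HG, Ht|].
  apply is_Cseries_decr_1.
  apply is_Cseries_ext with (fun n => t * (t ^ n * (INR (S n) * c (S n)))).
  { intros n. rewrite Cpow_S. ring. }
  evar_last; [apply is_Cseries_scal, HG', Ht|]. simpl INR. ring. }
assert (Hw : forall t : R, (0 <= t <= 1)%R -> 1 - t * z <> 0).
{ intros t Ht. apply neq_0_of_Re_gt_0, Re_1_minus_gt_0.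
  rewrite Cmod_mult, Cmod_R, Rabs_pos_eq by lra.
  assert (H := Cmod_ge_0 z). nra. }
assert (Hconst : G 0%R * Cexp (b * Clog (1 - 0%R * z)) =
  G 1%R * Cexp (b * Clog (1 - 1%R * z))).
{ apply (eq_of_is_derive_RC_0 (fun t => G t * Cexp (b * Clog (1 - t * z)))).
  intros t Ht.
  replace (RtoC 0) with (G' t * Cexp (b * Clog (1 - t * z)) +
    G t * (b * (- z / (1 - t * z)) * Cexp (b * Clog (1 - t * z)))).
  - apply is_derive_RC_mult; [now apply HD|].
    apply (is_derive_RC_Cexp (fun t => b * Clog (1 - t * z))).
    apply is_derive_RC_scal. now apply is_derive_RC_Clog_segment.
  - assert (H := Hw t Ht). specialize (ODE t Ht).
    transitivity (((1 - t * z) * G' t - b * z * G t) / (1 - t * z)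
      * Cexp (b * Clog (1 - t * z))); [field; exact H|].
    rewrite ODE. field. exact H. }
assert (G0 : G 0%R = 1).
{ unfold G. rewrite !PSeries_0. unfold cr, ci, c, binomial_term. simpl.
  unfold RtoC. f_equal; field. }
assert (L0 : Clog (1 - 0%R * z) = 0).
{ replace (1 - 0%R * z) with (RtoC 1) by ring.
  unfold Clog. rewrite Carg_atan, Cmod_1, ln_1 by (simpl; lra). simpl.
  unfold Rdiv. now rewrite Rmult_0_l, atan_0. }
rewrite G0, L0 in Hconst.
replace (b * 0) with (RtoC 0) in Hconst by ring.
replace (1 - 1%R * z) with (1 - z) in Hconst by ring.
rewrite Cexp_0 in Hconst.
assert (G1 : G 1%R = Cpower (1 - z) (- b)).
{ unfold Cpower. replace (- b * Clog (1 - z)) with (- (b * Clog (1 - z))) by ring.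
  assert (H := Cexp_opp (b * Clog (1 - z))).
  set (E := Cexp (b * Clog (1 - z))) in *.
  set (E' := Cexp (- (b * Clog (1 - z)))) in *.
  transitivity (G 1%R * (E' * E)); [rewrite H; ring|].
  transitivity (G 1%R * E * E'); [ring|]. rewrite <- Hconst. ring. }
rewrite <- G1.
apply is_Cseries_ext with (fun n => 1%R ^ n * c n).
{ intros n. rewrite Cpow_1_l. ring. }
apply HG. lra.
Qed.

(** Since [(b)_{m+n} = (b)_m (b + m)_n], this is the binomial series with parameter [b + m], scaled
    by [(b)_m]. *)
Lemma is_series_binomial_shift (b y : C) (m : nat) :
  (Cmod y < 1)%R ->
  is_series (V := C_NormedModule) (fun n => Cpoch b (m + n) / INR (fact n) * y ^ n)
    (Cpoch b m * (Cpower (1 - y) (- b) * (/ (1 - y)) ^ m)).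
Proof.
intros Hy.
rewrite <- Cpower_opp_plus_INR by (now apply neq_0_of_Re_gt_0, Re_1_minus_gt_0).
apply is_Cseries_ext with (fun n => Cpoch b m * binomial_term (b + INR m) y n).
{ intros n. unfold binomial_term. rewrite Cpoch_plus. unfold Cdiv. ring. }
now apply is_Cseries_scal, is_series_binomial.
Qed.

(** * Appell's series *)

Lemma F2_term_1_1_2_2 (a x y : C) (i j : nat) :
  F2_term a 1 1 2 2 x y i j =
    Cpoch a (i + j) / (INR (fact (S i)) * INR (fact (S j))) * x ^ i * y ^ j.
Proof.
unfold F2_term. rewrite !Cpoch_1, !Cpoch_2. field.
repeat split; apply C_fact_neq_0.
Qed.

Lemma fact_le_fact_S (n : nat) : (INR (fact n) <= INR (fact (S n)))%R.
Proof. apply le_INR, fact_le. lia. Qed.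

(** Lowering [(i+1)! (j+1)!] to [i! j!] gives a double series of binomial type, whose sums over [j]
    are known in closed form. *)
Lemma Cmod_F2_term_le (a x y : C) (A : R) (i j : nat) :
  (Cmod a <= A)%R ->
  (Cmod (F2_term a 1 1 2 2 x y i j) <=
   Cmod x ^ i / INR (fact i) * (Rpoch A (i + j) / INR (fact j) * Cmod y ^ j))%R.
Proof.
intros HA. rewrite F2_term_1_1_2_2.
assert (Hi := INR_fact_gt_0 i). assert (Hj := INR_fact_gt_0 j).
assert (Hi' := fact_le_fact_S i). assert (Hj' := fact_le_fact_S j).
rewrite !Cmod_mult, Cmod_div, Cmod_mult, !Cmod_pow, !Cmod_INR
  by (apply Cmult_neq_0; apply C_fact_neq_0).
set (p := (Cmod x ^ i)%R). set (q := (Cmod y ^ j)%R).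
assert (Hp : (0 <= p)%R) by apply pow_le, Cmod_ge_0.
assert (Hq : (0 <= q)%R) by apply pow_le, Cmod_ge_0.
replace (p / INR (fact i) * (Rpoch A (i + j) / INR (fact j) * q))%R
  with (Rpoch A (i + j) / (INR (fact i) * INR (fact j)) * p * q)%R
  by (field; lra).
do 2 (apply Rmult_le_compat_r; trivial).
apply Rmult_le_compat.
- apply Cmod_ge_0.
- apply Rlt_le, Rinv_0_lt_compat, Rmult_lt_0_compat; lra.
- now apply Cmod_Cpoch_le.
- apply Rinv_le_contravar; [now apply Rmult_lt_0_compat|].
  apply Rmult_le_compat; lra.
Qed.

Lemma is_series_Re (u : nat -> C) (l : C) :
  is_series (V := C_NormedModule) u l -> is_series (fun n => Re (u n)) (Re l).
Proof.
intros H.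
assert (E : forall n, sum_n (fun k => Re (u k)) n = Re (sum_n u n)).
{ induction n as [|n IH]; [now rewrite !sum_O|].
  rewrite !sum_Sn, IH. reflexivity. }
unfold is_series. apply filterlim_ext with (fun n => Re (sum_n u n)).
{ intros n. symmetry. apply E. }
apply (filterlim_comp _ _ _ (sum_n u) Re eventually (locally (T := C_UniformSpace) l)).
- exact H.
- intros P [eps HP]. exists eps. intros v [Hv _]. apply HP, Hv.
Qed.

(** Real part of the complex statement at real arguments. The witness is the real part of
    [(1 - Y)^(-A)]; what matters later is that it is independent of [i]. *)
Lemma is_series_Rpoch_shift (A Y : R) :
  (0 <= Y < 1)%R -> exists P, forall i,
  is_series (fun j => Rpoch A (i + j) / INR (fact j) * Y ^ j)%R
    (P * (Rpoch A i * (/ (1 - Y)) ^ i))%R.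
Proof.
intros HY. exists (Re (Cpower (1 - Y) (- A))). intros i.
assert (H1 : (Cmod Y < 1)%R) by (rewrite Cmod_R, Rabs_pos_eq; lra).
assert (H := is_series_Re _ _ (is_series_binomial_shift A Y i H1)).
replace (Re _) with (Re (Cpower (1 - Y) (- A)) * (Rpoch A i * (/ (1 - Y)) ^ i))%R in H.
- revert H. apply is_series_ext. intros j.
  rewrite <- RtoC_Rpoch, <- RtoC_div, <- RtoC_pow, <- RtoC_mult; [reflexivity|].
  apply Rgt_not_eq, INR_fact_gt_0.
- rewrite <- RtoC_Rpoch, <- RtoC_minus, <- RtoC_inv, <- RtoC_pow by lra.
  rewrite re_scal_l, re_scal_r. ring.
Qed.

(** The sums over [j] of the majorant are, up to the constant [P], the terms of the real binomial
    series at [Cmod x / (1 - Cmod y)], which is less than 1. *)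
Lemma F2_double_abs_convergent (a x y : C) :
  (Cmod x + Cmod y < 1)%R -> x <> 0 ->
  double_abs_convergent (F2_term a 1 1 2 2 x y).
Proof.
intros Hxy Hx. apply Cmod_gt_0 in Hx. assert (Hy := Cmod_ge_0 y).
assert (Ha := Cmod_ge_0 a).
(* The added 1 keeps [A] positive when [a = 0]. *)
set (A := (Cmod a + 1)%R). assert (HA : (0 < A)%R) by (unfold A; lra).
assert (HaA : (Cmod a <= A)%R) by (unfold A; lra).
destruct (is_series_Rpoch_shift A (Cmod y)) as [P HP]; [lra|].
set (u := fun i j => (Cmod x ^ i / INR (fact i) *
  (Rpoch A (i + j) / INR (fact j) * Cmod y ^ j))%R).
assert (Hle : forall i j, (0 <= Cmod (F2_term a 1 1 2 2 x y i j) <= u i j)%R).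
{ intros i j. split; [apply Cmod_ge_0|]. now apply Cmod_F2_term_le. }
assert (Hu : forall i, is_series (u i) (Cmod x ^ i / INR (fact i) *
  (P * (Rpoch A i * (/ (1 - Cmod y)) ^ i)))%R).
{ intros i. apply (is_series_scal (V := R_NormedModule)
    (Cmod x ^ i / INR (fact i))%R), HP. }
assert (Hex : forall i, ex_series (fun j => Cmod (F2_term a 1 1 2 2 x y i j))).
{ intros i. apply (ex_series_le (V := R_CompleteNormedModule)) with (u i).
  - intros j. change (norm ?v) with (Rabs v).
    rewrite Rabs_pos_eq; apply Hle.
  - eexists. apply Hu. }
split; [exact Hex|].
set (q := (Cmod x / (1 - Cmod y))%R).
assert (Hq : (0 < q < 1)%R).
{ unfold q. split; [apply Rdiv_lt_0_compat; lra|].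
  apply Rmult_lt_reg_r with (1 - Cmod y)%R; [lra|].
  unfold Rdiv. rewrite Rmult_assoc, Rinv_l; lra. }
apply (ex_series_le (V := R_CompleteNormedModule)) with
  (fun i => P * (Rpoch A i / INR (fact i) * q ^ i))%R.
- intros i. change (norm ?v) with (Rabs v).
  eapply Rle_trans.
  { apply Series_Rabs. apply ex_series_ext with (2 := Hex i).
    intros j. symmetry. apply Rabs_pos_eq, Cmod_ge_0. }
  apply Rle_trans with (Series (u i)).
  { apply Series_le; [|eexists; apply Hu].
    intros j. rewrite Rabs_pos_eq; apply Hle. }
  rewrite (is_series_unique _ _ (Hu i)). unfold q.
  unfold Rdiv. rewrite Rpow_mult_distr. right. ring.
- apply (ex_series_scal (V := R_NormedModule) P).
  now apply ex_series_binomial.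
Qed.

(** Prepending two factors to the Pochhammer symbol gives [(a - 2)_{i+j+2} = (a - 2) (a - 1)
    (a)_{i+j}], and [(a - 2) (a - 1) = (1 - a) (2 - a)]. The remaining [x * y] in the denominator
    compensates for raising both exponents by one. *)
Lemma F2_term_shift (a x y : C) (i j : nat) :
  a <> 1 -> a <> 2 -> x <> 0 -> y <> 0 ->
  F2_term a 1 1 2 2 x y i j =
    x ^ S i / INR (fact (S i)) / ((1 - a) * (2 - a) * x * y) *
    (Cpoch (a - 2) (S i + S j) / INR (fact (S j)) * y ^ S j).
Proof.
intros Ha1 Ha2 Hx Hy. rewrite F2_term_1_1_2_2.
replace (S i + S j)%nat with (2 + (i + j))%nat by lia.
rewrite (Cpoch_plus (a - 2) 2).
replace (a - 2 + INR 2) with a by (simpl INR; rewrite RtoC_plus; ring).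
rewrite !(Cpow_S _ i), !(Cpow_S _ j). cbn [Cpoch INR].
field. repeat split; trivial; try apply C_fact_neq_0;
  intros E; [apply Ha2|apply Ha1]; symmetry; now apply Ceq_minus.
Qed.

(** The triangle inequality gives [|1 - y| >= 1 - |y| > |x|]. *)
Lemma Cmod_div_1_minus_lt_1 (x y : C) :
  (Cmod x + Cmod y < 1)%R -> (Cmod (x / (1 - y)) < 1)%R.
Proof.
intros Hxy. assert (Hx := Cmod_ge_0 x).
assert (Hw : 1 - y <> 0) by (apply neq_0_of_Re_gt_0, Re_1_minus_gt_0; lra).
rewrite Cmod_div by exact Hw.
assert (H := Cmod_triangle (1 - y) y).
replace (1 - y + y) with (RtoC 1) in H by ring. rewrite Cmod_1 in H.
apply Rmult_lt_reg_r with (Cmod (1 - y)); [lra|].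
unfold Rdiv. rewrite Rmult_assoc, Rinv_l; lra.
Qed.

(** The factors [1 - y] and [1 - x / (1 - y)] and their product [1 - x - y] all have positive real
    part, so their principal logarithms add. *)
Lemma Cpower_1_minus_mult (x y c : C) :
  (Cmod x + Cmod y < 1)%R ->
  Cpower (1 - y) c * Cpower (1 - x / (1 - y)) c = Cpower (1 - x - y) c.
Proof.
intros Hxy. assert (Hx := Cmod_ge_0 x).
assert (Hy : (0 < Re (1 - y))%R) by (apply Re_1_minus_gt_0; lra).
assert (E : 1 - x - y = (1 - y) * (1 - x / (1 - y)))
  by (field; now apply neq_0_of_Re_gt_0).
unfold Cpower. rewrite <- Cexp_plus, E, Clog_mult.
- f_equal. ring.
- exact Hy.
- now apply Re_1_minus_gt_0, Cmod_div_1_minus_lt_1.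
- rewrite <- E. replace (1 - x - y) with (1 - (x + y)) by ring.
  apply Re_1_minus_gt_0. eapply Rle_lt_trans; [apply Cmod_triangle|exact Hxy].
Qed.

Theorem lemma2p1 (a x y : C) (ha1 : a <> 1) (ha2 : a <> 2)
    (hxy : (Cmod x + Cmod y < 1)%R) (hx : x <> 0) (hy : y <> 0) :
  double_abs_convergent (F2_term a 1 1 2 2 x y) /\
  F2 a 1 1 2 2 x y =
    (1 - Cpower (1 - x) (2 - a) - Cpower (1 - y) (2 - a)
       + Cpower (1 - x - y) (2 - a))
    / ((1 - a) * (2 - a) * x * y).
Proof.
split; [now apply F2_double_abs_convergent|].
assert (Hx := Cmod_ge_0 x). assert (Hy := Cmod_ge_0 y).
set (b := a - 2). replace (2 - a) with (- b) at 1 2 3 by (unfold b; ring).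
set (K := (1 - a) * (2 - a) * x * y).
set (row := fun m => Cpoch b m * (Cpower (1 - y) (- b) * (/ (1 - y)) ^ m)).
(* With [m = S i], the sum over [n = S j] is the full sum [row m] without its term at [n = 0], which
   is [(b)_m]. *)
assert (Hrow : forall i, CSeries (fun j => F2_term a 1 1 2 2 x y i j) =
  x ^ S i / INR (fact (S i)) / K * (row (S i) - Cpoch b (S i))).
{ intros i. apply CSeries_unique.
  apply is_Cseries_ext with (fun j => x ^ S i / INR (fact (S i)) / K *
    (Cpoch b (S i + S j) / INR (fact (S j)) * y ^ S j)).
  { intros j. symmetry. now apply F2_term_shift. }
  apply is_Cseries_scal.
  evar_last.
  { apply (is_Cseries_incr_1
      (fun n => Cpoch b (S i + n) / INR (fact n) * y ^ n)).
    apply is_series_binomial_shift. lra. }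
  rewrite Nat.add_0_r. unfold row. simpl fact. simpl INR. cbn [Cpow]. field.
  apply neq_0_of_Re_gt_0, Re_1_minus_gt_0. lra. }
unfold F2. apply CSeries_unique.
(* [row] and the subtracted [(b)_m] each yield a binomial series in [m = S i], lacking its term 1 at
   [m = 0]. The total is therefore [(1 - y)^(-b) ((1 - x/(1 - y))^(-b) - 1) - ((1 - x)^(-b) - 1)]
   divided by [K]. *)
apply is_Cseries_ext with (fun i => / K * (Cpower (1 - y) (- b) *
  binomial_term b (x / (1 - y)) (S i) + (- (1)) * binomial_term b x (S i))).
{ intros i. rewrite Hrow. unfold binomial_term, row, Cdiv.
  rewrite Cpow_mult_l. ring. }
evar_last.
{ apply is_Cseries_scal, is_Cseries_plus; apply is_Cseries_scal;
    apply is_Cseries_incr_1, is_series_binomial;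
    [now apply Cmod_div_1_minus_lt_1 | lra]. }
rewrite <- (Cpower_1_minus_mult x y (- b) hxy).
unfold binomial_term. simpl fact. simpl INR. cbn [Cpow Cpoch].
unfold Cdiv. replace (/ 1) with (RtoC 1) by field. ring.
Qed.
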